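(* Let $\mathcal{H}$ be a real Hilbert space, let $\mathcal{A}:\mathcal{H}\to 2^{\mathcal{H}}$ be a maximal monotone operator which has at least one zero, and let $\mathcal{M}$ be an admissible preconditioner of $\mathcal{A}$ with the onto decomposition $\mathcal{M}=\mathcal{C}\mathcal{C}^{*}$. Assume that $(\mathcal{M}+\mathcal{A})^{-1}$ is Lipschitz continuous. Let $\sigma\in[0,1)$, let $\lambda_k>0$ ($k\ge 1$) satisfy $\inf_k\lambda_k>0$, let $u^0\in\mathcal{H}$, and let $\{u^k\}_{k\ge 0}$, $\{\tilde u^{k}\}_{k\ge 1}$, $\{v^k\}_{k\ge 1}$ be sequences in $\mathcal{H}$ such that for all $k\ge 0$ $$\mathcal{M}v^{k+1}\in\mathcal{A}\tilde u^{k+1},$$ $$\|\lambda_{k+1}v^{k+1}+\tilde u^{k+1}-u^k\|_{\mathcal{M}}\le\sigma\|\tilde u^{k+1}-u^k\|_{\mathcal{M}},$$ $$u^{k+1}=u^k-\lambda_{k+1}v^{k+1}.$$ Then the sequence $\{\tilde u^k\}$ converges weakly to some $u^*\in\mathcal{H}$ with $0\in\mathcal{A}u^*$.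
   Context: A zero of $\mathcal{A}$ is a point $u$ with $0\in\mathcal{A}u$. An admissible preconditioner for a multivalued operator $\mathcal{A}:\mathcal{H}\to2^{\mathcal{H}}$ is a linear, bounded, self-adjoint and positive semidefinite operator $\mathcal{M}:\mathcal{H}\to\mathcal{H}$ such that $(\mathcal{M}+\mathcal{A})^{-1}\mathcal{M}$ is single-valued and has full domain. An onto decomposition of $\mathcal{M}$ is a factorization $\mathcal{M}=\mathcal{C}\mathcal{C}^*$ with $\mathcal{C}:\mathcal{D}\to\mathcal{H}$ linear, bounded and injective, $\mathcal{D}$ a real Hilbert space, such that $\mathcal{C}^*$ is onto. The seminorm induced by $\mathcal{M}$ is $\|x\|_{\mathcal{M}}=\sqrt{\langle x,\mathcal{M}x\rangle}$. ''$(\mathcal{M}+\mathcal{A})^{-1}$ is Lipschitz continuous'' means that the set-valued inverse of $\mathcal{M}+\mathcal{A}$ is point-to-point (single-valued on its domain) and Lipschitz continuous with respect to the norm of $\mathcal{H}$. *)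

(* Defs.v *)
From HB Require Import structures.
From mathcomp Require Import all_boot all_order all_algebra.
From mathcomp Require Import sesquilinear.
From mathcomp Require Import all_classical all_reals all_analysis.

Set Implicit Arguments.
Unset Strict Implicit.
Unset Printing Implicit Defensive.

Import Order.TTheory GRing.Theory Num.Theory.
Import numFieldNormedType.Exports.

Local Open Scope classical_set_scope.
Local Open Scope ring_scope.

HB.mixin Record NormedModule_isInnerProduct (R : realType) H
    of NormedModule R H := {
  inner : {dot H for (@idfun R)} ;
  inner_normE : forall x : H, inner x x = `|x| ^+ 2
}.

#[short(type="hilbertType")]
HB.structure Definition Hilbert (R : realType) :=
  {H of CompleteNormedModule R H & NormedModule_isInnerProduct R H}.

Section HilbertNotions.
Context {R : realType}.

Definition weakly_converges {H : hilbertType R} (u : nat -> H) (x : H) :=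
  forall y : H, inner (u n) y @[n --> \oo] --> inner x y.

Definition adjoint {U V : hilbertType R} (f : U -> V) (g : V -> U) :=
  forall x y, inner (f x) y = inner x (g y).

(* For a linear map, boundedness near 0 is boundedness as an operator
   (linear_boundedP). *)
Definition bounded_operator {U V : hilbertType R} (f : {linear U -> V}) :=
  bounded_near f (nbhs 0).

Definition seminorm_of {H : hilbertType R} (M : H -> H) (x : H) : R :=
  Num.sqrt (inner x (M x)).

End HilbertNotions.

(* [T x] is the set of values of the multivalued operator [T] at [x]. *)
Definition multi_op (U V : Type) := U -> set V.

Section MultivaluedOperators.
Context {U V W : Type}.

Definition multi_fun (f : U -> V) : multi_op U V := fun x => [set f x].

Definition multi_inv (T : multi_op U V) : multi_op V U :=
  fun y => [set x | T x y].

Definition multi_comp (S : multi_op V W) (T : multi_op U V) : multi_op U W :=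
  fun x => \bigcup_(y in T x) S y.

Definition multi_dom (T : multi_op U V) : set U := [set x | T x !=set0].

Definition single_valued (T : multi_op U V) := forall x, is_subset1 (T x).

End MultivaluedOperators.

Definition multi_add {U : Type} {V : zmodType} (S T : multi_op U V)
    : multi_op U V :=
  fun x => [set a + b | a in S x & b in T x].

Section Operators.
Context {R : realType} {H : hilbertType R}.

Definition zeros (A : multi_op H H) : set H := [set x | A x 0].

Definition monotone (A : multi_op H H) :=
  forall x y a b, A x a -> A y b -> 0 <= inner (x - y) (a - b).

Definition maximal_monotone (A : multi_op H H) :=
  monotone A /\
  forall B : multi_op H H, monotone B ->
    (forall x, A x `<=` B x) -> forall x, B x `<=` A x.

Definition lipschitz_operator (T : multi_op H H) :=
  exists f : H -> H,
    (forall x, multi_dom T x -> T x = [set f x]) /\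
    [lipschitz f x | x in multi_dom T].

Record admissible_preconditioner (A : multi_op H H) (M : {linear H -> H})
    : Prop := AdmissiblePreconditioner {
  admissible_bounded : bounded_operator M ;
  admissible_self_adjoint : adjoint M M ;
  admissible_positive : forall x, 0 <= inner x (M x) ;
  admissible_single_valued : single_valued
    (multi_comp (multi_inv (multi_add (multi_fun M) A)) (multi_fun M)) ;
  admissible_full_domain : multi_dom
    (multi_comp (multi_inv (multi_add (multi_fun M) A)) (multi_fun M)) = setT
}.

(* [Cstar] is the adjoint of [C], which [adjoint] determines uniquely. *)
Record onto_decomposition {D : hilbertType R} (M : H -> H)
    (C : {linear D -> H}) (Cstar : H -> D) : Prop := OntoDecomposition {
  decomposition_bounded : bounded_operator C ;
  decomposition_injective : injective C ;
  decomposition_adjoint : adjoint C Cstar ;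
  decomposition_onto : range Cstar = setT ;
  decomposition_eq : forall x, M x = C (Cstar x)
}.

End Operators.

(* Main.v *)
From HB Require Import structures.
Require Import Defs.
From mathcomp Require Import all_boot all_order all_algebra.
From mathcomp Require Import all_classical all_reals all_analysis.
From mathcomp Require Import sesquilinear.
From mathcomp Require Import ring lra.

Import Order.TTheory GRing.Theory Num.Theory.
Import numFieldNormedType.Exports.

Local Open Scope classical_set_scope.
Local Open Scope ring_scope.

(** The problem is first pushed to [D].  Put [p = Cstar u], [q = Cstar utilde]
    and [w = Cstar v].  Since [M = C Cstar], the M-seminorm of [x] is the norm of
    [Cstar x], and [inner x (M y) = inner (Cstar x) (Cstar y)].  The recursion
    therefore becomes a hybrid proximal extragradient step in [D], and
    monotonicity of [A] at a zero [z] reads [0 <= inner (q - Cstar z) w].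
    Expanding squares ([relative_error_step]) gives
      |p' - Cstar z|^2 + (1 - sigma^2) |q - p|^2 <= |p - Cstar z|^2.
    Hence [|p - Cstar z|] converges for every zero [z], [q - p] tends to 0 and,
    as the step sizes stay away from 0, so does [w]
    ([relative_error_descent]).

    The seminorm controls only the component of [utilde] seen by [M]; the
    Lipschitz hypothesis recovers the rest.  Indeed [utilde] is the value of
    (M + A)^-1 at [M (utilde + v)], and [M] is bounded by the seminorm, so
    [utilde] is bounded in [H].  For the same reason a zero [z] is determined
    by [Cstar z] ([zeros_adjoint_inj]).

    Every weak limit of [utilde] is a zero, because [M v] belongs to
    [A utilde], [M v] tends to 0 strongly and the graph of [A] is closed for
    weak-strong convergence.  Two weak limits [x] and [x'] coincide by the Opial
    argument: [|p - Cstar x|^2 - |p - Cstar x'|^2] converges, so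
    [inner utilde (C d)] converges for [d = Cstar x - Cstar x'], so
    [inner (x - x') (C d) = |d|^2] vanishes, and [x = x'] by the previous
    paragraph.

    Weak sequential compactness is used through ultrafilters: along an
    ultrafilter every bounded sequence of scalars converges, so a bounded
    sequence of vectors defines a bounded linear functional, which the Riesz
    theorem represents by its weak limit.  A bounded sequence with only one
    weak limit along the ultrafilters finer than [\oo] converges weakly
    ([weakly_converges_unique_ultra_limit]). *)

(** * Inner products *)

Section InnerProduct.
Context {R : realType} {H : hilbertType R}.
Implicit Types x y z : H.

Lemma innerC x y : inner x y = inner y x.
Proof. by rewrite hermC /= expr0 mul1r. Qed.

Lemma innerZl a x y : inner (a *: x) y = a * inner x y.
Proof. by rewrite linearZl. Qed.

Lemma innerZr a x y : inner x (a *: y) = a * inner x y.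
Proof. by rewrite linearZr. Qed.

Lemma sqr_normB x y :
  `|x - y| ^+ 2 = `|x| ^+ 2 - 2 * inner x y + `|y| ^+ 2.
Proof.
rewrite -!inner_normE linearBl !linearBr /= [inner y x]innerC; ring.
Qed.

Lemma sqr_normD x y :
  `|x + y| ^+ 2 = `|x| ^+ 2 + 2 * inner x y + `|y| ^+ 2.
Proof.
rewrite -!inner_normE linearDl !linearDr /= [inner y x]innerC; ring.
Qed.

Lemma cauchy_schwarz x y : `|inner x y| <= `|x| * `|y|.
Proof.
rewrite -ler_sqr ?nnegrE ?mulr_ge0// real_normK ?num_real// exprMn.
have [->|y0] := eqVneq y 0; first by rewrite linear0r normr0 !expr0n /= mulr0.
have y2 : 0 < `|y| ^+ 2 by rewrite exprn_gt0// normr_gt0.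
have : 0 <= `| `|y| ^+ 2 *: x - inner x y *: y| ^+ 2 by exact: sqr_ge0.
rewrite sqr_normB !normrZ innerZl innerZr !exprMn real_normK ?num_real//.
rewrite real_normK ?num_real//.
set a := `|x| ^+ 2; set b := `|y| ^+ 2; set c := inner x y => h.
suff : 0 <= b * (a * b - c ^+ 2) by rewrite pmulr_rge0// subr_ge0.
by apply: le_trans h _; rewrite le_eqVlt; apply/orP; left; apply/eqP; ring.
Qed.

Lemma inner_inj x y : (forall h, inner x h = inner y h) -> x = y.
Proof.
move=> xy; apply/eqP; rewrite -subr_eq0 -normr_eq0 -sqrf_eq0 -inner_normE.
by rewrite linearBl /= xy subrr.
Qed.

End InnerProduct.

(** * The Riesz representation theorem *)

Section Riesz.
Context {R : realType} {H : hilbertType R}.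

(** The representing vector minimizes [J x = |x|^2 - 2 l x].  The parallelogram
    identity makes every minimizing sequence Cauchy, and the first-order
    condition at the minimum is [l h = inner x h]. *)
Lemma riesz_representation (l : H -> R) (B : R) :
  linear_for *%R l -> (forall h, `|l h| <= B * `|h|) ->
  exists x, forall h, l h = inner x h.
Proof.
move=> l_lin l_bound.
have lP a x y : l (a *: x + y) = a * l x + l y by exact: l_lin.
have lD x y : l (x + y) = l x + l y by rewrite -(mul1r (l x)) -lP scale1r.
have l0 : l 0 = 0 by have := lD 0 0; rewrite addr0; lra.
have lZ a x : l (a *: x) = a * l x by rewrite -[a *: x]addr0 lP l0 addr0.
pose J x := `|x| ^+ 2 - 2 * l x.
have J_lb x : - B ^+ 2 <= J x.
  have := l_bound x; have := sqr_ge0 (`|x| - B); have := ler_norm (l x).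
  by rewrite /J sqrrB => h1 h2 h3; lra.
have J_inf : has_inf (range J).
  split; first by exists (J 0), 0.
  by exists (- B ^+ 2) => _ [x _ <-]; exact: J_lb.
set m := inf (range J).
have m_le x : m <= J x by apply: ge_inf; [exact: J_inf.2|exists x].
(* parallelogram identity, with J bounded below by m at the midpoint *)
have J_mid x y : `|x - y| ^+ 2 <= 2 * (J x - m) + 2 * (J y - m).
  have := m_le (2^-1 *: (x + y)).
  rewrite /J lZ lD normrZ ger0_norm ?invr_ge0// exprMn sqr_normB sqr_normD.
  by lra.
have /choice[s s_min] n : exists x, J x < m + n.+1%:R^-1.
  have n0 : 0 < n.+1%:R^-1 :> R by rewrite invr_gt0.
  by have [_ [x _ <-] Jx] := inf_adherent n0 J_inf; exists x.
have s_dist n k : `|s n - s k| ^+ 2 <= 2 * n.+1%:R^-1 + 2 * k.+1%:R^-1.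
  apply: le_trans (J_mid _ _) _.
  have := s_min n; have := s_min k.
  by set a := n.+1%:R^-1; set b := k.+1%:R^-1 => *; lra.
have s_cvg : cvgn s.
  apply/cauchy_cvgP/cauchy_ballP => e e0; near_simpl.
  have e4 : 0 < e ^+ 2 / 4 by rewrite divr_gt0// exprn_gt0.
  have N := near_infty_natSinv_lt (PosNum e4).
  exists (
    [set n | n.+1%:R^-1 < e ^+ 2 / 4], [set n | n.+1%:R^-1 < e ^+ 2 / 4]).
    by split; exact: N.
  move=> [n k] /= [hn hk]; rewrite -ball_normE /=.
  rewrite -ltr_sqr ?nnegrE// ?ltW//.
  by apply: le_lt_trans (s_dist _ _) _; move: hn hk;
  by set a := n.+1%:R^-1; set b := k.+1%:R^-1 => *; lra.
pose x := lim (s @ \oo).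
have sx : s @ \oo --> x by exact: s_cvg.
have lsx : l (s n) @[n --> \oo] --> l x.
  apply/cvgrPdist_le => e e0.
  have B0 : 0 < `|B| + 1 by rewrite ltr_wpDl.
  have /cvgrPdist_le/(_ (e / (`|B| + 1))) := sx.
  rewrite divr_gt0// => /(_ isT); apply: filterS => n hn.
  have -> : l x - l (s n) = l (x - s n).
    by rewrite [x - s n]addrC -(scaleN1r (s n)) lP; ring.
  apply: le_trans (l_bound _) _; rewrite ler_pdivlMr// in hn.
  have := ler_norm B; have : 0 <= `|x - s n| by []. nra.
have Jx : J x <= m.
  have Js : J (s n) @[n --> \oo] --> J x.
    apply: cvgB; last exact: cvgMl_tmp.
    by rewrite expr2; under eq_fun do rewrite expr2; apply: cvgM; apply: cvg_norm.
  have mn : m + n.+1%:R^-1 @[n --> \oo] --> m + 0.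
    by apply: cvgD; [exact: cvg_cst|exact: cvg_harmonic].
  rewrite -[m in _ <= m]addr0.
  apply: ler_cvg_to Js mn _; apply: nearW => n; exact: ltW.
exists x => h.
(* t |-> J (x + t h) - J x is a nonnegative quadratic polynomial without
   constant term, so its linear coefficient vanishes *)
have quad t : 0 <= t ^+ 2 * `|h| ^+ 2 + 2 * t * (inner x h - l h).
  have := le_trans Jx (m_le (t *: h + x)).
  rewrite /J lP sqr_normD innerZl normrZ exprMn real_normK ?num_real//.
  by rewrite [inner h x]innerC; lra.
set d := inner x h - l h in quad *.
suff : d = 0 by rewrite /d; lra.
have a0 : 0 <= `|h| ^+ 2 by exact: sqr_ge0.
(* close to the minimizer - d / |h|^2, but also defined when h = 0 *)
have := quad (- d / (`|h| ^+ 2 + 1)).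
set a := `|h| ^+ 2 in a0 *; have a1 : 0 < a + 1 by lra.
set c := (a + 1)^-1; have c0 : 0 < c by rewrite invr_gt0.
have ca : c * (a + 1) = 1 by rewrite mulVf// gt_eqF.
have -> : (- d / (a + 1)) ^+ 2 * a + 2 * (- d / (a + 1)) * d
   = - (d ^+ 2 * c) * (1 + c).
  have -> : a = (a + 1) - 1 by ring.
  rewrite subrK mulrBr mulr1 exprMn -/c.
  have -> : (- d) ^+ 2 * c ^+ 2 * (a + 1) = d ^+ 2 * c * (c * (a + 1)) by ring.
  rewrite ca; ring.
rewrite mulNr oppr_ge0 => dc.
have c1 : 0 < 1 + c by rewrite addr_gt0.
have : d ^+ 2 * c * (1 + c) == 0.
  by rewrite eq_le dc /= pmulr_lge0 // pmulr_lge0 // sqr_ge0.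
by rewrite !mulf_eq0 (gt_eqF c0) (gt_eqF c1) !orbF orbb => /eqP.
Qed.

End Riesz.

(** * Weak compactness along ultrafilters *)

Definition weakly_converges_along {R : realType} {H : hilbertType R} {I : Type}
    (F : set_system I) (y : I -> H) (x : H) :=
  forall h : H, inner (y i) h @[i --> F] --> inner x h.

Section WeakCompactness.
Context {R : realType} {H : hilbertType R}.

Lemma bounded_ultra_cvg {I : Type} {F : set_system I} {a : I -> R} {B : R} :
  UltraFilter F -> (forall i, `|a i| <= B) -> cvg (a @ F).
Proof.
move=> F_ultra aB.
have aFB : (a @ F) `[- B, B]%classic.
  by apply: nearW => i /=; rewrite in_itv /= -ler_norml.
have [p [_ p_clus]] := segment_compact (fmap_proper_filter a _) aFB.
apply/cvg_ex; exists p => V pV.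
(* a neighborhood of the cluster point has its preimage in F, since otherwise
   its complement would have it *)
have [//|FnV] := in_ultra_setVsetC (a @^-1` V) F_ultra.
by have [t [nVt Vt]] := p_clus (~` V) V FnV pV.
Qed.

(** The scalar limits of [inner (y i) h] depend linearly on [h] and are bounded
    by [B * |h|], so Riesz turns them into a vector. *)
Lemma bounded_ultra_weakly_cvg {I : Type} {F : set_system I} {y : I -> H}
    {B : R} :
  UltraFilter F -> (forall i, `|y i| <= B) ->
  exists x, weakly_converges_along F y x.
Proof.
move=> F_ultra yB.
have ipB h i : `|inner (y i) h| <= B * `|h|.
  by apply: le_trans (cauchy_schwarz _ _) _; rewrite ler_wpM2r.
pose l h := lim (inner (y i) h @[i --> F]).
have lE h : inner (y i) h @[i --> F] --> l h.
  exact: bounded_ultra_cvg F_ultra (ipB h).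
have [|h|x lx] := @riesz_representation _ _ l B.
- move=> a h k.
  have E : inner (y i) (a *: h + k) @[i --> F] --> a * l h + l k.
    under eq_fun do rewrite linearDr /= innerZr.
    by apply: cvgD; [exact: cvgMl_tmp|exact: lE].
  exact: cvg_unique (lE (a *: h + k)) E.
- apply: cvgr_to_le (cvg_norm (lE h)) _.
  by apply: nearW => i; exact: ipB.
- by exists x => h; rewrite -lx; exact: lE.
Qed.

Lemma weak_limit_inner {F : set_system nat} {FF : ProperFilter F}
    {y : nat -> H} {x h : H} {c : R} :
  \oo `<=` F -> weakly_converges_along F y x ->
  inner (y n) h @[n --> \oo] --> c -> inner x h = c.
Proof.
move=> F_oo yx yc; apply: (cvg_unique _ (yx h)) => //.
by move=> V Vc; exact/F_oo/(yc V Vc).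
Qed.

(** If [inner (y n) h] fails to converge to [inner x h], infinitely many indices
    stay away from the limit; an ultrafilter concentrated on these indices has a
    weak limit other than [x]. *)
Lemma weakly_converges_unique_ultra_limit {y : nat -> H} {B : R} {P : set H} :
  (forall n, `|y n| <= B) ->
  (forall F x, UltraFilter F -> \oo `<=` F ->
     weakly_converges_along F y x -> P x) ->
  (forall F G x x', UltraFilter F -> \oo `<=` F ->
     UltraFilter G -> \oo `<=` G ->
     weakly_converges_along F y x -> weakly_converges_along G y x' -> x = x') ->
  exists2 x, P x & weakly_converges y x.
Proof.
move=> yB yP y_uniq.
have [F [F_ultra F_oo]] := ultraFilterLemma eventually_filter.
have [x Fx] := bounded_ultra_weakly_cvg F_ultra yB.
exists x; first exact: yP Fx.
move=> h V xV; apply: contrapT => nV.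
set W := [set n | V (inner (y n) h)] in nV *.
have W_proper : ProperFilter (within (~` W) \oo).
  apply: Build_ProperFilter => /= [[N _ NW]]; apply: nV; exists N => // n Nn.
  by apply: contrapT; exact: NW.
have [G [G_ultra G_within]] := ultraFilterLemma W_proper.
have G_oo : \oo `<=` G.
  by move=> U Uoo; apply: G_within; apply: filterS Uoo => n Un _.
have [x' Gx'] := bounded_ultra_weakly_cvg G_ultra yB.
have xx' : x = x' by exact: (y_uniq F G).
have GW : G W by rewrite xx' in xV; exact: (Gx' h V xV).
have GnW : G (~` W) by apply: G_within; apply: nearW.
by have [n [Wn /(_ Wn)]] := filter_ex (filterI GW GnW).
Qed.

End WeakCompactness.

(** * Maximal monotone operators *)

Section MonotoneOperators.
Context {R : realType} {H : hilbertType R}.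

(** Adding the pair [(x, c)] to the graph of [A] keeps it monotone, so by
    maximality it was already there. *)
Lemma maximal_monotone_mem {A : multi_op H H} {x c : H} :
  maximal_monotone A ->
  (forall a b, A a b -> 0 <= inner (x - a) (c - b)) -> A x c.
Proof.
move=> [A_mono A_max] xc.
pose B : multi_op H H := fun a => [set b | A a b \/ a = x /\ b = c].
apply: (A_max B) => [a a' b b'|a b Aab|]; [|by left|by right].
move=> [Aab|[-> ->]] [Aab'|[-> ->]]; last by rewrite !subrr linear0l.
- exact: A_mono.
- by rewrite -opprB -[b - c]opprB linearNl linearNr /= opprK; exact: xc.
- exact: xc.
Qed.

(** In [0 <= inner (y - a) (m - b)] the factor [y] may converge only weakly:
    replacing [m] by [c] costs at most [(B + |a|) * |m - c|], which tends to 0. *)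
Lemma maximal_monotone_demiclosed {I : Type} {F : set_system I}
    {A : multi_op H H} {y m : I -> H} {x c : H} {B : R} :
  ProperFilter F -> maximal_monotone A -> (forall i, A (y i) (m i)) ->
  (forall i, `|y i| <= B) -> weakly_converges_along F y x ->
  `|m i - c| @[i --> F] --> 0 -> A x c.
Proof.
move=> FF A_max Aym yB yx mc.
apply: (maximal_monotone_mem A_max) => a b Aab.
have limL : inner (y i - a) (c - b) @[i --> F] --> inner (x - a) (c - b).
  under eq_fun do rewrite linearBl /=.
  by rewrite linearBl /=; apply: cvgB; [exact: yx|exact: cvg_cst].
have lim_sum : inner (y i - a) (c - b) + (B + `|a|) * `|m i - c| @[i --> F]
    --> inner (x - a) (c - b) + (B + `|a|) * 0.
  by apply: cvgD limL _; exact: (cvgMl_tmp mc).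
rewrite mulr0 addr0 in lim_sum.
apply: (cvgr_to_ge lim_sum); apply: nearW => i.
have Amono := A_max.1 _ _ _ _ (Aym i) Aab.
have split_m : inner (y i - a) (m i - b) =
    inner (y i - a) (m i - c) + inner (y i - a) (c - b).
  have -> : m i - b = (m i - c) + (c - b) by rewrite addrA subrK.
  by rewrite linearDr.
have bnd : inner (y i - a) (m i - c) <= (B + `|a|) * `|m i - c|.
  apply: le_trans (ler_norm _) _; apply: le_trans (cauchy_schwarz _ _) _.
  rewrite ler_wpM2r//; apply: le_trans (ler_normB _ _) _.
  by rewrite lerD2r.
by rewrite split_m in Amono; lra.
Qed.

End MonotoneOperators.

(** * Fejer monotonicity of relative-error proximal steps *)

Section Fejer.
Context {R : realType} {D : hilbertType R}.

Lemma vanishing_norm_bounded {V : normedModType R} {x : nat -> V} :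
  `|x k| @[k --> \oo] --> 0 -> exists B, forall k, `|x k| <= B.
Proof.
move=> x0; have /cvg_seq_bounded/pinfty_ex_gt0[B _ xB] := cvgP _ x0.
by exists B => k; have := xB k I; rewrite /= normr_id.
Qed.

(** Polarization: the term [|p k|^2], which may diverge, cancels in the
    difference of the two squared distances. *)
Lemma fejer_inner_cvg {p : nat -> D} {a b : D} :
  cvgn (fun k => `|p k - a| ^+ 2) -> cvgn (fun k => `|p k - b| ^+ 2) ->
  cvgn (fun k => inner (p k) (a - b)).
Proof.
move=> pa pb.
have -> : (fun k => inner (p k) (a - b)) =
    (fun k => 2^-1 * (`|p k - b| ^+ 2 - `|p k - a| ^+ 2
                      + (`|a| ^+ 2 - `|b| ^+ 2))).
  apply/funext => k; rewrite !sqr_normB linearBr /=.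
  set s := inner (p k) a; set t := inner (p k) b; lra.
apply: is_cvgMr; apply: is_cvgD; last exact: is_cvg_cst.
exact: is_cvgB.
Qed.

(** Expanding [|(p - z) - lam w|^2], the cross term splits along
    [p - z = (q - z) - (q - p)]; the first part is nonnegative by monotonicity,
    and what remains is [|lam w + (q - p)|^2 - |q - p|^2], which the error
    criterion bounds. *)
Lemma relative_error_step (p q w z : D) (lam sigma : R) :
  0 < lam -> 0 <= inner (q - z) w ->
  `|lam *: w + q - p| <= sigma * `|q - p| ->
  `|p - lam *: w - z| ^+ 2 + (1 - sigma ^+ 2) * `|q - p| ^+ 2
    <= `|p - z| ^+ 2.
Proof.
move=> lam0 qzw err.
have err2 : `|lam *: w + (q - p)| ^+ 2 <= sigma ^+ 2 * `|q - p| ^+ 2.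
  rewrite -exprMn addrA lerXn2r// nnegrE//.
  by apply: le_trans err.
rewrite (sqr_normD (lam *: w)) innerZl in err2.
have -> : p - lam *: w - z = (p - z) - lam *: w by rewrite addrAC.
rewrite sqr_normB innerZr.
have split_p : inner (p - z) w = inner (q - z) w - inner w (q - p).
  rewrite [inner w _]innerC !linearBl /=; ring.
have := mulr_ge0 (ltW lam0) qzw; rewrite split_p mulrBr; lra.
Qed.

(** [w] vanishes because [lam |w| <= (1 + sigma) |q - p|] with [lam] bounded
    below by [lam0]. *)
Lemma relative_error_descent {p q w : nat -> D} {lam : nat -> R}
    {sigma lam0 : R} {z : D} :
  0 <= sigma < 1 -> 0 < lam0 -> (forall k, lam0 <= lam k) ->
  (forall k, `|lam k *: w k + q k - p k| <= sigma * `|q k - p k|) ->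
  (forall k, p k.+1 = p k - lam k *: w k) ->
  (forall k, 0 <= inner (q k - z) (w k)) ->
  [/\ forall k, `|p k - z| <= `|p 0%N - z|,
      cvgn (fun k => `|p k - z| ^+ 2),
      `|q k - p k| @[k --> \oo] --> 0 &
      `|w k| @[k --> \oo] --> 0].
Proof.
move=> /andP[sigma0 sigma1] lam00 lam_ge err p_step q_mono.
have lam_gt k : 0 < lam k by apply: lt_le_trans (lam_ge k).
pose a k := `|p k - z| ^+ 2.
have s1 : 0 < 1 - sigma ^+ 2 by rewrite subr_gt0 expr_lt1.
have a_step k : a k.+1 + (1 - sigma ^+ 2) * `|q k - p k| ^+ 2 <= a k.
  by rewrite /a p_step; exact: relative_error_step.
have a_noninc : nonincreasing_seq a.
  apply/nonincreasing_seqP => k; apply: le_trans (a_step k).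
  by rewrite lerDl mulr_ge0 ?sqr_ge0 ?ltW.
have a_cvg : cvgn a.
  apply: nonincreasing_is_cvgn => //.
  by exists 0 => _ [k _ <-]; exact: sqr_ge0.
have qp0 : `|q k - p k| @[k --> \oo] --> 0.
  have da : (a k - a k.+1) / (1 - sigma ^+ 2) @[k --> \oo] --> 0.
    rewrite -(mul0r (1 - sigma ^+ 2)^-1) -(subrr (limn a)).
    by apply: cvgMr_tmp; apply: cvgB => //; rewrite cvg_shiftS.
  apply/cvgrPdist_lt => e e0.
  have /cvgrPdist_lt/(_ (e ^+ 2)) := da.
  rewrite exprn_gt0// => /(_ isT); apply: filterS => k.
  rewrite !sub0r !normrN normr_id => ak.
  rewrite -ltr_sqr ?nnegrE// ?ltW//.
  apply: le_lt_trans ak; apply: le_trans (ler_norm _).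
  by rewrite ler_pdivlMr//; have := a_step k; lra.
split=> //.
- move=> k; rewrite -ler_sqr ?nnegrE//; exact: (a_noninc 0%N k).
- have bnd : (1 + sigma) / lam0 * `|q k - p k| @[k --> \oo] --> 0.
    by rewrite -(mulr0 ((1 + sigma) / lam0)); exact: cvgMl_tmp.
  apply: (squeeze_cvgr _ (cvg_cst 0) bnd); apply: nearW => k.
  rewrite normr_ge0 /= mulrAC ler_pdivlMr// mulrC.
  apply: (@le_trans _ _ (lam k * `|w k|)); first by rewrite ler_wpM2r.
  rewrite -[lam k]gtr0_norm// -normrZ.
  have -> : lam k *: w k = (lam k *: w k + q k - p k) - (q k - p k).
    by rewrite -[X in X - _]addrA addrK.
  apply: le_trans (ler_normB _ _) _.
  by have := err k; rewrite mulrDl mul1r; lra.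
Qed.

End Fejer.

(** * Preconditioners and their decompositions *)

Section Decomposition.
Context {R : realType} {H D : hilbertType R}.
Context {M : {linear H -> H}} {C : {linear D -> H}} {Cstar : H -> D}.
Hypothesis dec : onto_decomposition M C Cstar.

Let adj := decomposition_adjoint dec.

Lemma decomposition_linear : linear Cstar.
Proof.
move=> a x y; apply: inner_inj => h.
rewrite [LHS]innerC -adj linearDr linearDl /= innerZr innerZl.
by rewrite !adj [inner h (Cstar x)]innerC [inner h (Cstar y)]innerC.
Qed.

Let P : {linear H -> D} :=
  HB.pack Cstar (GRing.isLinear.Build R H D *:%R Cstar decomposition_linear).

Lemma decomposition_linearD x y : Cstar (x + y) = Cstar x + Cstar y.
Proof. exact: (linearD P). Qed.

Lemma decomposition_linearB x y : Cstar (x - y) = Cstar x - Cstar y.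
Proof. exact: (linearB P). Qed.

Lemma decomposition_linearZ a x : Cstar (a *: x) = a *: Cstar x.
Proof. exact: (linearZ_LR P). Qed.

Lemma decomposition_inner x y : inner x (M y) = inner (Cstar x) (Cstar y).
Proof. by rewrite (decomposition_eq dec) innerC adj innerC. Qed.

Lemma decomposition_seminorm x : seminorm_of M x = `|Cstar x|.
Proof.
by rewrite /seminorm_of decomposition_inner inner_normE sqrtr_sqr normr_id.
Qed.

Lemma decomposition_le_norm :
  exists2 K, 0 <= K & forall x, `|M x| <= K * `|Cstar x|.
Proof.
have /linear_boundedP/pinfty_ex_gt0[K K0 CK] := decomposition_bounded dec.
by exists K; [exact: ltW|move=> x; rewrite (decomposition_eq dec)].
Qed.

End Decomposition.

Section LipschitzInverse.
Context {R : realType} {H : hilbertType R}.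
Context {A : multi_op H H} {M : {linear H -> H}}.
Hypothesis MA_lip : lipschitz_operator (multi_inv (multi_add (multi_fun M) A)).

(** If [a] belongs to [A x], then [x] is the value of (M + A)^-1 at [M x + a]. *)
Lemma lipschitz_inverse_le : exists2 L, 0 <= L &
  forall x a y b, A x a -> A y b -> `|x - y| <= L * `|M (x - y) + (a - b)|.
Proof.
have [f [fE f_lip]] := MA_lip.
have mem x a : A x a -> multi_inv (multi_add (multi_fun M) A) (M x + a) x.
  by move=> Axa; exists (M x) => //; exists a.
have f_val x a : A x a -> f (M x + a) = x.
  move=> Axa; have := mem x a Axa; rewrite fE; first by move=> /= <-.
  by exists x; exact: mem.
have [L L0 fL] := pinfty_ex_gt0 f_lip.
exists L => [|x a y b Ax Ay]; first exact: ltW.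
rewrite -[in X in `|X| <= _](f_val x a Ax) -[in X in `|X| <= _](f_val y b Ay).
have -> : M (x - y) + (a - b) = (M x + a) - (M y + b).
  by rewrite linearB /= opprD !addrA [M x - _ + a]addrAC.
by apply: (fL (M x + a, M y + b)); split; [exists x|exists y]; exact: mem.
Qed.

Context {D : hilbertType R} {C : {linear D -> H}} {Cstar : H -> D}.
Hypothesis dec : onto_decomposition M C Cstar.

(** [M x = M x'] as soon as [Cstar x = Cstar x'], and (M + A)^-1 maps this common
    value to both zeros. *)
Lemma zeros_adjoint_inj x x' :
  zeros A x -> zeros A x' -> Cstar x = Cstar x' -> x = x'.
Proof.
move=> Ax Ax' xx'; have [L _ A_lip] := lipschitz_inverse_le.
apply/eqP; rewrite -subr_eq0 -normr_le0.
apply: le_trans (A_lip _ _ _ _ Ax Ax') _.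
rewrite subr0 addr0 (decomposition_eq dec) (decomposition_linearB dec).
by rewrite xx' subrr linear0 normr0 mulr0.
Qed.

(** Boundedness in the seminorm of [M] lifts to the norm of [H]: the points
    [y k] are values of the Lipschitz map (M + A)^-1 at [M (y k + m k)]. *)
Lemma bounded_of_adjoint_bounded (y m : nat -> H) (z : H) (B : R) :
  zeros A z -> (forall k, A (y k) (M (m k))) ->
  (forall k, `|Cstar (y k) - Cstar z + Cstar (m k)| <= B) ->
  exists B', forall k, `|y k| <= B'.
Proof.
move=> Az Aym ymB.
have [L L0 A_lip] := lipschitz_inverse_le.
have [K K0 M_le] := decomposition_le_norm dec.
exists (L * (K * B) + `|z|) => k.
rewrite -[y k](subrK z); apply: le_trans (ler_normD _ _) _; rewrite lerD2r.
apply: le_trans (A_lip _ _ _ _ (Aym k) Az) _; rewrite subr0 -linearD /=.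
rewrite ler_wpM2l//; apply: le_trans (M_le _) _; rewrite ler_wpM2l//.
by rewrite (decomposition_linearD dec) (decomposition_linearB dec).
Qed.

End LipschitzInverse.

(** * Convergence of the method *)

Theorem theorem2p6 (R : realType) (H D : hilbertType R)
    (A : multi_op H H) (M : {linear H -> H})
    (C : {linear D -> H}) (Cstar : H -> D)
    (A_maximal : maximal_monotone A)
    (A_zero : zeros A !=set0)
    (M_admissible : admissible_preconditioner A M)
    (M_decomposition : onto_decomposition M C Cstar)
    (MA_lipschitz : lipschitz_operator (multi_inv (multi_add (multi_fun M) A)))
    (sigma : R) (sigma_ge0 : 0 <= sigma) (sigma_lt1 : sigma < 1)
    (lambda : nat -> R)
    (lambda_gt0 : forall k, (1 <= k)%N -> 0 < lambda k)
    (lambda_inf : 0 < inf [set lambda k | k in [set k | (1 <= k)%N]])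
    (u utilde v : nat -> H)
    (v_mem : forall k, A (utilde k.+1) (M (v k.+1)))
    (error_bound : forall k,
       seminorm_of M (lambda k.+1 *: v k.+1 + utilde k.+1 - u k)
         <= sigma * seminorm_of M (utilde k.+1 - u k))
    (u_update : forall k, u k.+1 = u k - lambda k.+1 *: v k.+1) :
  exists2 ustar : H, zeros A ustar & weakly_converges utilde ustar.
Proof.
have adj := decomposition_adjoint M_decomposition.
have PD := decomposition_linearD M_decomposition.
have PB := decomposition_linearB M_decomposition.
have PZ := decomposition_linearZ M_decomposition.
(* utilde starts at index 1, hence the shift *)
pose y k := utilde k.+1.
pose p k := Cstar (u k).
pose q k := Cstar (y k).
pose w k := Cstar (v k.+1).
have lam_ge k : inf [set lambda k | k in [set k | (1 <= k)%N]] <= lambda k.+1.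
  apply: ge_inf; last by exists k.+1.
  by exists 0 => _ [n /= n1 <-]; exact/ltW/lambda_gt0.
have err k : `|lambda k.+1 *: w k + q k - p k| <= sigma * `|q k - p k|.
  have := error_bound k.
  by rewrite !(decomposition_seminorm M_decomposition) !PB PD PZ.
have p_step k : p k.+1 = p k - lambda k.+1 *: w k.
  by rewrite /p u_update PB PZ.
have q_mono z k : zeros A z -> 0 <= inner (q k - Cstar z) (w k).
  move=> Az; have := A_maximal.1 _ _ _ _ (v_mem k) Az.
  by rewrite subr0 (decomposition_inner M_decomposition) PB.
have sigma01 : 0 <= sigma < 1 by rewrite sigma_ge0.
have descent z (Az : zeros A z) :=
  relative_error_descent (lam := fun k => lambda k.+1)
    sigma01 lambda_inf lam_ge err p_step (fun k => q_mono z k Az).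
have [z0 Az0] := A_zero.
have [p_bnd _ qp0 w0] := descent z0 Az0.
have [B y_bnd] : exists B, forall k, `|y k| <= B.
  have [Bqp qp_bnd] := vanishing_norm_bounded qp0.
  have [Bw w_bnd] := vanishing_norm_bounded w0.
  apply: (bounded_of_adjoint_bounded MA_lipschitz M_decomposition y
    (fun k => v k.+1) z0 (Bqp + `|p 0%N - Cstar z0| + Bw)) => // k.
  rewrite -/(q k) -/(w k) -[q k](subrK (p k)) -[_ + p k - _]addrA.
  apply: le_trans (ler_normD _ _) _; apply: lerD => //.
  by apply: le_trans (ler_normD _ _) _; apply: lerD.
have Mv0 : `|M (v k.+1) - 0| @[k --> \oo] --> 0.
  have [K _ M_le] := decomposition_le_norm M_decomposition.
  have Kw0 : K * `|w k| @[k --> \oo] --> 0.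
    by rewrite -(mulr0 K); exact: cvgMl_tmp.
  apply: (squeeze_cvgr _ (cvg_cst 0) Kw0); apply: nearW => k.
  by rewrite normr_ge0 subr0 /= M_le.
have limit_zero F x : UltraFilter F -> \oo `<=` F ->
    weakly_converges_along F y x -> zeros A x.
  move=> F_ultra F_oo yx.
  apply: (maximal_monotone_demiclosed _ A_maximal v_mem y_bnd yx) => V V0.
  exact/F_oo/(Mv0 V V0).
have limit_uniq F G x x' : UltraFilter F -> \oo `<=` F ->
    UltraFilter G -> \oo `<=` G ->
    weakly_converges_along F y x -> weakly_converges_along G y x' -> x = x'.
  move=> F_ultra F_oo G_ultra G_oo yx yx'.
  have Ax := limit_zero F x F_ultra F_oo yx.
  have Ax' := limit_zero G x' G_ultra G_oo yx'.
  apply: (zeros_adjoint_inj MA_lipschitz M_decomposition) => //.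
  set d := Cstar x - Cstar x'.
  have [_ px _ _] := descent x Ax.
  have [_ px' _ _] := descent x' Ax'.
  have pd := fejer_inner_cvg px px'.
  have yd : inner (y k) (C d) @[k --> \oo] --> lim (inner (p k) d @[k --> \oo]).
    have qpd : inner (q k - p k) d @[k --> \oo] --> 0.
      apply: norm_cvg0.
      have bd : `|q k - p k| * `|d| @[k --> \oo] --> 0.
        by rewrite -(mul0r `|d|); exact: cvgMr_tmp.
      apply: (squeeze_cvgr _ (cvg_cst 0) bd); apply: nearW => k.
      by rewrite normr_ge0 cauchy_schwarz.
    have -> : (fun k => inner (y k) (C d)) =
        (fun k => inner (q k - p k) d + inner (p k) d).
      by apply/funext => k; rewrite innerC adj innerC -linearDl /= subrK.
    by rewrite -[X in _ --> X]add0r; apply: cvgD.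
  have xd : inner x (C d) = inner x' (C d).
    by rewrite (weak_limit_inner F_oo yx yd) (weak_limit_inner G_oo yx' yd).
  (* |d|^2 = inner (x - x') (C d) *)
  apply/eqP; rewrite -subr_eq0 -normr_eq0 -sqrf_eq0 -inner_normE.
  by rewrite -/d {1}/d -PB innerC -adj innerC linearBl /= xd subrr.
have [x Ax yx] :=
  weakly_converges_unique_ultra_limit y_bnd limit_zero limit_uniq.
by exists x => // h; rewrite -cvg_shiftS; exact: yx.
Qed.
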